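(* For every $k\geq 3$ we have $\mathrm{rhv}_{k-2}(k)\leq 5/9$.
   Context: A $(1,k)$-graph is a hypergraph whose vertex set is partitioned into colors and points $V$ such that every edge contains exactly one color and exactly $k$ points; a $(1,d)$-set consists of one color and $d$ points. For a $(1,k)$-graph $R$ on $[t]\cup V$ with $|V|=t$, the relative degree of a $(1,d)$-set $S$ is $\deg_R(S)/\binom{t-d}{k-d}$. The link graph $L_R(S)$ of a $(1,\ell)$-set $S$ is the $(k-\ell)$-graph on $V$ with edges $\{X:X\cup S\in E(R)\}$. The shadow $\partial_j(R)$ is the $(1,j)$-graph of $(1,j)$-sets contained in edges of $R$; $\overline{\partial_j(R)}$ is its complement among all $(1,j)$-sets; $R_i:=R[\{i\}\cup V]$. Edge density of a $k$-graph on $t$ vertices is (number of edges)$/\binom tk$. A graph is tightly connected if any two edges are joined by a tight walk (vertex sequence whose consecutive pairs are edges). A switcher is an edge $ab$ whose ends have a common neighbour. A fractional matching of a graph $G$ is $\mathbf{w}:E(G)\to[0,1]$ with $\sum_{e\ni v}\mathbf{w}(e)\le 1$; its density is $\sum_e\mathbf{w}(e)/|V(G)|$. $x\ll y$: for every $y\in(0,1]$ there is $x_0$ such that the statements hold for all $x\le x_0$ (hierarchies read right to left). A $(k-2)$-vicinity for color $i$ is $\mathcal{C}_i=\{C_S\subseteq L_R(S): S\in\partial_{k-2}(R), i\in S\}$. An arc for $\mathcal{C}_i$ is $(i,v_1,\dots,v_{k+1})$ with $\{i,v_1,\dots,v_{k-2}\},\{i,v_2,\dots,v_{k-1}\}\in\partial_{k-2}(R_i)$,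 $\{v_{k-1},v_k\}\in C_{\{i,v_1,\dots,v_{k-2}\}}$ and $\{v_k,v_{k+1}\}\in C_{\{i,v_2,\dots,v_{k-1}\}}$. A family $\{\mathcal{C}_i\}_{i\in[t]}$ is $(\gamma,\delta)$-rainbow Hamilton if for all $S,S'\in\partial_{k-2}(R_i)$, $T\in\partial_{k-2}(R_j)$, $i\ne j$: (V1) $C_S$ tightly connected; (V2) $C_S,C_{S'}$ share an edge; (V3) $C_S$ has a switcher and $\mathcal{C}_i$ has an arc; (V4) $C_S$ has a fractional matching of density $(1+1/k)(1/(k+1)+\gamma)$; (V5) $C_S$ has edge density at least $1-\delta+\gamma$; (V6) $C_S,C_T$ share an edge. $R$ has $\alpha$-perturbed minimum relative $(1,k-2)$-degree at least $\delta$ if for all $j\in[k-2]$: (P1) every edge of $\partial_j(R)$ has relative degree at least $\delta$ in $R$; (P2) $\overline{\partial_j(R)}$ has edge density at most $\alpha$; (P3) every $(1,j-1)$-set of $\partial_{j-1}(R)$ has relative degree less than $\alpha$ in $\overline{\partial_j(R)}$. $\mathrm{rhv}_{k-2}(k)$ is the smallest $\delta>0$ such that whenever $1/t\ll\alpha\ll\gamma\ll\mu$ and $R$ is a $(1,k)$-graph on $[t]\cup V$, $|V|=t$, such that each $R_i$ has $\alpha$-perturbed minimum relative $(1,k-2)$-degree at least $\delta+\mu$, then $R$ admits a $(\gamma,\delta)$-rainbow Hamilton family of $(k-2)$-vicinities. *)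

(* Defs.v *)
From HB Require Import structures.
From mathcomp Require Import all_boot all_order all_algebra.
From mathcomp Require Import all_classical all_reals all_analysis.

Set Implicit Arguments.
Unset Strict Implicit.
Unset Printing Implicit Defensive.

Import Order.TTheory GRing.Theory Num.Theory.

Local Open Scope ring_scope.

(* A (1,j)-set, consisting of the colour i and the j points of X, is encoded as
   the pair (i, X).  The point set of a (1,k)-graph is all of V, while its
   colour set is only a subset of C, so that R and R_i have the same type. *)
Record graph1 (C V : finType) (k : nat) := Graph1 {
  colours : {set C};
  edges : {set C * {set V}};
  edgesP : [forall e in edges, (e.1 \in colours) && (#|e.2| == k)]
}.

Definition sub1 (C V : finType) (S e : C * {set V}) : bool :=
  (S.1 == e.1) && (S.2 \subset e.2).

Section Graph1Operations.
Variables (C V : finType) (k : nat).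
Implicit Types (H : graph1 C V k) (S : C * {set V}).

Definition shadow_edges j H : {set C * {set V}} :=
  [set S : C * {set V} | (#|S.2| == j) && [exists e in edges H, sub1 S e]].

Lemma shadow_edgesP j H :
  [forall S in shadow_edges j H, (S.1 \in colours H) && (#|S.2| == j)].
Proof.
apply/forall_inP => S; rewrite inE => /andP[-> /exists_inP[e eH /andP[/eqP-> _]]].
by have /forall_inP/(_ e eH)/andP[-> _] := edgesP H.
Qed.

Definition shadow j H : graph1 C V j := Graph1 (shadow_edgesP j H).

Definition compl_edges H : {set C * {set V}} :=
  [set S : C * {set V} |
    [&& S.1 \in colours H, #|S.2| == k & S \notin edges H]].

Lemma compl_edgesP H :
  [forall S in compl_edges H, (S.1 \in colours H) && (#|S.2| == k)].
Proof. by apply/forall_inP => S; rewrite inE => /and3P[-> ->]. Qed.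

Definition compl H : graph1 C V k := Graph1 (compl_edgesP H).

Definition at_colour_edges H (i : C) : {set C * {set V}} :=
  [set e in edges H | e.1 == i].

Lemma at_colour_edgesP H i :
  [forall e in at_colour_edges H i,
     (e.1 \in colours H :&: [set i]) && (#|e.2| == k)].
Proof.
apply/forall_inP => e; rewrite !inE => /andP[eH ->].
by have /forall_inP/(_ e eH)/andP[-> ->] := edgesP H.
Qed.

(* R_i = R[{i} \cup V] *)
Definition at_colour H i : graph1 C V k := Graph1 (at_colour_edgesP H i).

Definition deg H S : nat := #|[set e in edges H | sub1 S e]|.

Definition link H S : {set {set V}} :=
  [set X : {set V} | [disjoint X & S.2] & (S.1, X :|: S.2) \in edges H].

End Graph1Operations.

Definition rel_deg (R : realType) (C V : finType) (k : nat)
    (H : graph1 C V k) (S : C * {set V}) : R :=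
  (deg H S)%:R / 'C(#|V| - #|S.2|, k - #|S.2|)%:R.

(* The proportion of the (1,k)-sets on the colours of H that are edges of H;
   for R_i there is one colour and the denominator is binom(t, k). *)
Definition density1 (R : realType) (C V : finType) (k : nat)
    (H : graph1 C V k) : R :=
  (#|edges H|)%:R / (#|colours H| * 'C(#|V|, k))%:R.

Definition perturbed_min_degree (R : realType) (C V : finType) (k : nat)
    (alpha delta : R) (H : graph1 C V k) : Prop :=
  forall j : nat, (1 <= j <= k - 2)%N ->
  [/\ forall S, S \in edges (shadow j H) -> delta <= rel_deg R H S,
      density1 R (compl (shadow j H)) <= alpha
    & forall S, S \in edges (shadow j.-1 H) ->
        rel_deg R (compl (shadow j H)) S < alpha].

(* A graph on the vertex set V is given by its set of edges, which are sets of
   two vertices. *)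
Section Graphs.
Variable V : finType.
Implicit Type E : {set {set V}}.

Definition adj E : rel V := fun a b => [set a; b] \in E.

(* The walk s starts with the two vertices of e and ends with those of f. *)
Definition tightly_connected E : Prop :=
  forall e f, e \in E -> f \in E ->
  exists s : seq V,
    [/\ sorted (adj E) s,
        [set x in take 2 s] = e
      & [set x in drop (size s - 2) s] = f].

Definition has_switcher E : Prop :=
  exists a b c : V, [/\ adj E a b, adj E a c & adj E b c].

Definition share_edge E E' : Prop := exists e, e \in E /\ e \in E'.

Definition edge_density (R : realType) E : R := #|E|%:R / 'C(#|V|, 2)%:R.

Definition fractional_matching (R : realType) E (w : {set V} -> R) : Prop :=
  (forall e, e \in E -> 0 <= w e <= 1) /\
  (forall v : V, \sum_(e in E | v \in e) w e <= 1).

Definition matching_density (R : realType) E (w : {set V} -> R) : R :=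
  (\sum_(e in E) w e) / #|V|%:R.

End Graphs.

Section Vicinities.
Variables (R : realType) (C V : finType) (k : nat).
Implicit Types (H : graph1 C V k).

(* CC S is the graph C_S; only its values on the edges of the shadow matter. *)
Implicit Type CC : C * {set V} -> {set {set V}}.

Definition vicinities H CC : Prop :=
  forall S, S \in edges (shadow (k - 2) H) -> CC S \subset link H S.

(* The points v_1, ..., v_{k+1} are v 1, ..., v k.+1; other values of v are
   irrelevant. *)
Definition is_arc H CC (i : C) (v : nat -> V) : Prop :=
  let S1 := (i, [set v m.+1 | m : 'I_(k - 2)]) in
  let S2 := (i, [set v m.+2 | m : 'I_(k - 2)]) in
  [/\ S1 \in edges (shadow (k - 2) (at_colour H i)),
      S2 \in edges (shadow (k - 2) (at_colour H i)),
      [set v (k - 1)%N; v k] \in CC S1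
    & [set v k; v k.+1] \in CC S2].

Definition rainbow_hamilton (gamma delta : R) H CC : Prop :=
  let D i := edges (shadow (k - 2) (at_colour H i)) in
  [/\ forall i, i \in colours H -> forall S, S \in D i ->
        tightly_connected (CC S),
      forall i, i \in colours H -> forall S S', S \in D i ->
        S' \in D i -> share_edge (CC S) (CC S'),
      forall i, i \in colours H ->
        (forall S, S \in D i -> has_switcher (CC S)) /\
        (exists v, is_arc H CC i v),
      forall i, i \in colours H -> forall S, S \in D i ->
        exists2 w : {set V} -> R, fractional_matching (CC S) w &
          matching_density (CC S) w
            = (1 + k%:R^-1) * ((k.+1)%:R^-1 + gamma)
    & (forall i, i \in colours H -> forall S, S \in D i ->
        1 - delta + gamma <= edge_density R (CC S)) /\
      (forall i j, i \in colours H -> j \in colours H -> i != j ->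
        forall S T, S \in D i -> T \in D j -> share_edge (CC S) (CC T))].

End Vicinities.

(* The hierarchy 1/t << alpha << gamma << mu is read from right to left. *)
Definition forces_rainbow_hamilton (R : realType) (k : nat) (delta : R) : Prop :=
  forall mu : R, 0 < mu <= 1 ->
  exists2 gamma0 : R, 0 < gamma0 & forall gamma : R, 0 < gamma <= gamma0 ->
  exists2 alpha0 : R, 0 < alpha0 & forall alpha : R, 0 < alpha <= alpha0 ->
  exists2 x0 : R, 0 < x0 & forall t : nat, (0 < t)%N -> t%:R^-1 <= x0 ->
  forall (V : finType) (H : graph1 'I_t V k),
    #|V| = t -> colours H = [set: 'I_t]%SET ->
    (forall i, perturbed_min_degree alpha (delta + mu) (at_colour H i)) ->
  exists2 CC : 'I_t * {set V} -> {set {set V}},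
    vicinities H CC & rainbow_hamilton gamma delta H CC.

(* Taken in the extended reals, so that the infimum of an empty set of
   thresholds would be +oo rather than a default real value. *)
Definition rhv (R : realType) (k : nat) : \bar R :=
  ereal_inf [set delta%:E | delta in
    [set delta : R | 0 < delta /\ forces_rainbow_hamilton k delta]%classic]%classic.

(* Main.v *)
(* The graph C_S is the restriction of the link L of S to a connected component A
   with at least 2/3 of the t points.  A largest component is that large, as
   the component sizes a_1, a_2, ... (in units of t) satisfy
   max a_i >= sum a_i^2 >= 5/9 and a_1^2 + (1 - a_1)^2 >= 5/9.  With a = a_1,
   C_S misses at most (1 - a)^2 <= 1/9 of the edge density of L, whence (V5),
   and it is dense enough inside A for a triangle (Mantel) and, because some
   vertex x has more than t/3 neighbours, for an arc: exchange the first point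
   of S for x.
   Two such graphs on sets of relative sizes a, a' that share no edge would
   leave uncovered at least (a + a' - 1)^2 in total, forcing |a - a'| > 1/3.
   For (V4), Konig's theorem on the bipartite double cover of C_S gives either
   a half-integral matching of weight s or a cover of size c <= 2s; if b is the
   proportion of points used twice by the cover, the density of C_S is at most
   2ab - b^2 + (c - 2b)^2, which is convex in b and too small for s close to
   1/3. *)
Require Import Defs.
From mathcomp Require Import all_boot all_order all_algebra.
From mathcomp Require Import all_classical all_reals all_analysis.
From mathcomp Require Import fintype finset zify ring lra.

Set Implicit Arguments.
Unset Strict Implicit.
Unset Printing Implicit Defensive.

Import Order.TTheory GRing.Theory Num.Theory.

(** * Konig's theorem for bipartite graphs *)

Section Konig.
Variables U W : finType.
Implicit Types (E M : {set U * W}) (X : {set U}) (Y : {set W}).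

Definition covers E X Y := [forall p in E, (p.1 \in X) || (p.2 \in Y)].

(** The vertex cover number of the bipartite graph E is at least m. Being boolean, the predicate can
    be fed to [minset] to get an inclusion-minimal edge set. *)
Definition cover_ge m E :=
  [forall X : {set U}, forall Y : {set W}, covers E X Y ==> (m <= #|X| + #|Y|)%N].

Lemma cover_geP m E :
  reflect (forall X Y, covers E X Y -> (m <= #|X| + #|Y|)%N) (cover_ge m E).
Proof.
apply: (iffP forallP) => [h X Y c|h X]; last by apply/forallP=> Y; apply/implyP/h.
by have /forallP/(_ Y)/implyP/(_ c) := h X.
Qed.

Lemma coversD1 E e X Y :
  covers (E :\ e) X Y -> (e.1 \in X) || (e.2 \in Y) -> covers E X Y.
Proof.
move=> /forall_inP h he; apply/forall_inP=> p pE.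
by have [->//|ne] := eqVneq p e; apply: h; rewrite !inE ne.
Qed.

(* Removing either of two edges at x gives a cover of size < m missing x;
   uncrossing the two covers gives two covers of total size < 2m. *)
Lemma minimal_cover_ge_inj1 m M :
  minset (cover_ge m) M -> {in M &, injective fst}.
Proof.
move=> /minsetP[/cover_geP hM minM] e f eM fM /= ef.
apply: contraTeq isT => nef.
have drop g : g \in M -> exists X Y,
    [/\ covers (M :\ g) X Y, (#|X| + #|Y| < m)%N, g.1 \notin X & g.2 \notin Y].
  move=> gM; have /cover_geP : ~~ cover_ge m (M :\ g).
    apply/negP => h; have := minM _ h (subD1set _ _) => /setP/(_ g).
    by rewrite !inE eqxx gM.
  move=> /existsNP[X /existsNP[Y /not_implyP[c /negP]]].
  rewrite -ltnNge => lt; exists X, Y.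
  have : ~~ ((g.1 \in X) || (g.2 \in Y)).
    by apply/negP => /(coversD1 c)/hM; rewrite leqNgt lt.
  by rewrite negb_or => /andP[].
have [Xe [Ye [ce lte xe ye]]] := drop _ eM.
have [Xf [Yf [cf ltf xf yf]]] := drop _ fM.
have he p : p \in M -> p != e -> (p.1 \in Xe) || (p.2 \in Ye).
  by move=> pM pe; move/forall_inP: ce => /(_ p); rewrite !inE pe; apply.
have hf p : p \in M -> p != f -> (p.1 \in Xf) || (p.2 \in Yf).
  by move=> pM pf; move/forall_inP: cf => /(_ p); rewrite !inE pf; apply.
(* The covers [c1] and [c2] have total size at most 2(m - 1) + 1, the extra point being [e.1], so
   one of them has fewer than m points. *)
have c1 : covers M (e.1 |: (Xe :|: Xf)) (Ye :&: Yf).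
  apply/forall_inP => p pM; rewrite !inE.
  have [->|pe] := eqVneq p e; first by rewrite eqxx.
  have [->|pf] := eqVneq p f; first by rewrite ef eqxx.
  by case/orP: (he _ pM pe) => ->; case/orP: (hf _ pM pf) => ->; rewrite ?orbT.
have c2 : covers M (Xe :&: Xf) (Ye :|: Yf).
  apply/forall_inP => p pM; rewrite !inE.
  have [->|pe] := eqVneq p e.
    by have := hf _ eM nef; rewrite ef (negbTE xf) /= => ->; rewrite ?orbT.
  have [->|pf] := eqVneq p f.
    have : f != e by rewrite eq_sym.
    by move/(he _ fM); rewrite -ef (negbTE xe) /= => ->; rewrite ?orbT.
  by case/orP: (he _ pM pe) => ->; case/orP: (hf _ pM pf) => ->; rewrite ?orbT.
have := hM _ _ c1; have := hM _ _ c2.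
have := cardsU1 e.1 (Xe :|: Xf); have := cardsUI Xe Xf; have := cardsUI Ye Yf.
case: (e.1 \notin _) => /=; move: lte ltf; clear; lia.
Qed.

End Konig.

Lemma cover_ge_swap (U W : finType) m (E : {set U * W}) :
  cover_ge m E -> cover_ge m (@swap_pair U W @: E).
Proof.
move=> /cover_geP h; apply/cover_geP => Y X /forall_inP c.
rewrite addnC; apply: h; apply/forall_inP => p pE.
by rewrite orbC; apply: (c (p.2, p.1)); apply: imset_f.
Qed.

(** An inclusion-minimal edge set with cover number at least m is a matching: the minimality
    argument applies to it and to its reversal. Its first coordinates cover it, so it has at least m
    edges. *)
Lemma konig (U W : finType) (m : nat) (E : {set U * W}) : cover_ge m E ->
  exists M : {set U * W}, [/\ M \subset E, {in M &, injective fst},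
    {in M &, injective snd} & (m <= #|M|)%N].
Proof.
move=> hE; have [M mM ME] := minset_exists hE; exists M.
have inj1 := minimal_cover_ge_inj1 mM.
have swapKs (U' W' : finType) (F : {set U' * W'}) :
    @swap_pair W' U' @: (@swap_pair U' W' @: F) = F.
  by rewrite -imset_comp (eq_imset (g := id)) ?imset_id//; case.
have inj2 : {in @swap_pair U W @: M &, injective fst}.
  apply: (minimal_cover_ge_inj1 (m := m)); apply/minsetP; split.
    by apply: cover_ge_swap; case/minsetP: mM.
  move=> F /cover_ge_swap hF FM; case/minsetP: mM => _ /(_ _ hF) <-.
    by rewrite swapKs.
  by rewrite -(swapKs _ _ M) imsetS.
split=> //.
- by move=> p q pM qM /= e; have := inj2 _ _ (imset_f _ pM) (imset_f _ qM) e;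
    case: p {pM} e => ? ?; case: q {qM} => ? ? /= -> [->].
- case/minsetP: mM => /cover_geP/(_ (fst @: M) set0) + _.
  rewrite cards0 addn0 card_in_imset//; apply.
  by apply/forall_inP => p pM; rewrite imset_f.
Qed.

(** * Graphs, their ordered edges, and large components *)

(** These are the edges of the bipartite double cover. Ordered pairs also make densities comparable
    with products of sets. *)
Definition arcs (V : finType) (E : {set {set V}}) : {set V * V} :=
  [set p | adj E p.1 p.2].

Definition nbrs (V : finType) (E : {set {set V}}) (u : V) : {set V} :=
  [set v | adj E u v].

Definition is_graph (V : finType) (E : {set {set V}}) : Prop :=
  forall e, e \in E -> #|e| = 2.

Definition induced_graph (V : finType) (E : {set {set V}}) (A : {set V}) :=
  [set e in E | e \subset A].

(** Connectedness and closedness together say that a nonempty A is a whole component of E. *)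
Definition giant (V : finType) (E : {set {set V}}) (A : {set V}) : Prop :=
  [/\ {in A &, forall u v, connect (adj E) u v},
      forall u v, adj E u v -> u \in A -> v \in A
    & 2 * #|V| <= 3 * #|A|].

Lemma card_fibers (U W : finType) (Q : {set U * W}) :
  #|Q| = \sum_u #|[set w | (u, w) \in Q]|.
Proof.
rewrite -sum1_card (eq_bigr (fun u => \sum_(w | (u, w) \in Q) 1)); last first.
  by move=> u _; rewrite -sum1_card; apply: eq_bigl => w; rewrite inE.
by rewrite pair_big_dep /=; apply: eq_bigl => -[].
Qed.

(* For t - a = b and t - a' = b' the claim reduces to 9 (b - b')^2 <= t^2. *)
Lemma intersection_arith (t a a' x c c' d d' : nat) :
  2 * t <= 3 * a -> 2 * t <= 3 * a' -> a <= t -> a' <= t -> a + a' <= t + x ->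
  5 * (t * t) < 9 * d -> 5 * (t * t) < 9 * d' ->
  d <= c + (t - a) * (t - a) -> d' <= c' + (t - a') * (t - a') ->
  c <= a * a -> c' <= a' * a' ->
  a * a - c + (a' * a' - c') < x * x.
Proof.
move=> h1 h2 h3 h4 h5 h6 h7 h8 h9 h10 h11.
have [b e] : exists b, t = a + b by exists (t - a); lia.
have [b' e'] : exists b', t = a' + b' by exists (t - a'); lia.
have eb : t - a = b by lia.
have eb' : t - a' = b' by lia.
rewrite eb eb' in h8 h9.
have p1 : (t - b - b') * (t - b - b') <= x * x by apply: leq_mul; lia.
have [s es] : exists s, t = s + b + b' by exists (t - b - b'); lia.
have ea : a = s + b' by lia.
have ea' : a' = s + b by lia.
have ss : t - b - b' = s by lia.
rewrite ss in p1.
(* Since b and b' are at most t/3, 3|b - b'| <= t. With truncated subtraction, the order of b and b'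
   decides which of [q] and [q'] carries this. *)
have q : (3 * b - 3 * b') * (3 * b - 3 * b') <= t * t by apply: leq_mul; lia.
have q' : (3 * b' - 3 * b) * (3 * b' - 3 * b) <= t * t by apply: leq_mul; lia.
clear eb eb' ss h1 h2 e e' h3 h4 h5; subst a a'.
case: (leqP b' b) => l.
  have [r er] : exists r, b = b' + r by exists (b - b'); lia.
  have er' : 3 * b - 3 * b' = 3 * r by lia.
  rewrite er' in q; clear q' er' l; subst b t.
  lia.
have [r er] : exists r, b' = b + r by exists (b' - b); lia.
have er' : 3 * b' - 3 * b = 3 * r by lia.
rewrite er' in q'; clear q er' l; subst b' t.
lia.
Qed.

Section Graph.
Variable V : finType.
Implicit Types (E : {set {set V}}) (A X Y : {set V}).

Lemma adjC E u v : adj E u v = adj E v u.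
Proof. by rewrite /adj setUC. Qed.

Lemma adj_induced E A u v :
  adj (induced_graph E A) u v = [&& adj E u v, u \in A & v \in A].
Proof. by rewrite /adj inE subUset !sub1set. Qed.

Lemma graph_induced E A : is_graph E -> is_graph (induced_graph E A).
Proof. by move=> g e; rewrite inE => /andP[/g]. Qed.

Lemma card_arcs_nbrs E : #|arcs E| = \sum_u #|nbrs E u|.
Proof.
rewrite card_fibers; apply: eq_bigr => u _; apply: eq_card => v.
by rewrite !inE.
Qed.

Lemma card_orderings (e : {set V}) :
  #|e| = 2 -> #|[set p : V * V | [set p.1; p.2] == e]| = 2.
Proof.
move=> /eqP/cards2P[a [b [ab ->]]].
rewrite (_ : [set p | _]%SET = [set (a, b); (b, a)]%SET).
  by rewrite cards2 xpair_eqE (negbTE ab).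
apply/setP => -[u v]; rewrite !inE !xpair_eqE /=.
apply/eqP/orP => [h|[] /andP[/eqP-> /eqP->] //]; last by rewrite setUC.
have : u != v.
  by have := cards2 u v; rewrite h cards2 ab; case: (u =P v).
have : v \in [set a; b]%SET by rewrite -h set22.
have : u \in [set a; b]%SET by rewrite -h set21.
by move=> /set2P[] -> /set2P[] ->; rewrite !eqxx //; auto.
Qed.

Lemma card_arcs E : is_graph E -> #|arcs E| = 2 * #|E|.
Proof.
move=> g; rewrite -sum1_card.
rewrite (partition_big (fun p => [set p.1; p.2]%SET) (mem E)) /=; last first.
  by move=> p; rewrite inE.
rewrite mulnC -sum_nat_const; apply: eq_bigr => e eE.
rewrite -[RHS](card_orderings (g e eE)) -sum1_card; apply: eq_bigl => p.
by rewrite !inE /adj; case: eqP => [->|_]; rewrite ?andbT ?eE ?andbF.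
Qed.

(** Let A be a largest component and a its share of the points. Degrees are at most |A|, so a >=
    5/9; this rules out a <= 1/3, the other solution range of a^2 + (1 - a)^2 >= 5/9. *)
Lemma giant_exists E : is_graph E -> 5 * #|V| ^ 2 <= 9 * #|arcs E| ->
  exists A, giant E A.
Proof.
move=> gE; case: (pickP (@predT V)) => [x0 _ large|V0]; last first.
  move=> _; exists set0.
  by split=> [u v|u v _|]; rewrite ?inE // (eq_card0 V0).
have [v0 _ vmax] := @arg_maxnP V x0 xpredT
  (fun v => #|[set u | connect (adj E) v u]|) isT.
set A := [set u | connect (adj E) v0 u].
have sc : connect_sym (adj E) by apply: sym_connect_sym => u v; rewrite adjC.
have closedA u v : adj E u v -> (u \in A) = (v \in A).
  move=> uv; rewrite !inE; apply/idP/idP => h; apply: connect_trans h _.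
    exact: connect1.
  by apply: connect1; rewrite adjC.
exists A; split.
- by move=> u v; rewrite !inE => h; apply: connect_trans; rewrite sc.
- by move=> u v /closedA->.
have le1 : #|arcs E| <= #|V| * #|A|.
  rewrite card_arcs_nbrs -sum_nat_const; apply: leq_sum => u _.
  apply: leq_trans (vmax u isT); apply/subset_leq_card/subsetP => v.
  by rewrite !inE; apply: connect1.
have le2 : #|arcs E| <= #|A| ^ 2 + #|~: A| ^ 2.
  rewrite -!mulnn -!cardsX; apply: leq_trans (leq_card_setU _ _).1.
  apply/subset_leq_card/subsetP => -[u v]; rewrite inE /= => uv.
  by rewrite in_setU !in_setX !in_setC /= -(closedA _ _ uv) !andbb orbN.
have := cardsC A; have : 0 < #|V| by apply/card_gt0P; exists x0.
move: large le1 le2; rewrite -!mulnn.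
move: #|~: A| #|A| #|V| #|arcs E| => b a t d; clear; nia.
Qed.

(** No edge leaves a component, so the arcs lost by restriction to A have both ends outside A. *)
Lemma card_arcs_giant E A : giant E A ->
  #|arcs E| <= #|arcs (induced_graph E A)| + (#|V| - #|A|) ^ 2.
Proof.
move=> [_ cl _]; rewrite -(cardsC A) addKn -mulnn -cardsX.
apply: leq_trans (leq_card_setU _ _).1; apply/subset_leq_card/subsetP => -[u v].
rewrite !inE /= adj_induced => uv; rewrite uv /=.
case: (boolP (u \in A)) => [/(cl _ _ uv)-> //|uA].
by apply: contra uA; apply: cl; rewrite adjC.
Qed.

Lemma giant_nbr E A u : 1 < #|A| -> giant E A -> u \in A ->
  exists v, adj (induced_graph E A) u v.
Proof.
move=> A1 [co cl _] uA.
have [w /andP[wA wu]] : exists w, (w \in A) && (w != u).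
  have /card_gt0P[w] : 0 < #|A :\ u| by move: A1; rewrite (cardsD1 u) uA.
  by rewrite !inE andbC; exists w.
have /connectP[[|v p] /=] := co u w uA wA; first by move=> _ e; rewrite e eqxx in wu.
by move=> /andP[uv _] _; exists v; rewrite adj_induced uv uA (cl _ _ uv).
Qed.

(** For graphs a tight walk is an ordinary walk: join an end of e to an end of f by a path and
    append the other two ends. *)
Lemma giant_tightly_connected E A : is_graph E -> giant E A ->
  tightly_connected (induced_graph E A).
Proof.
move=> gE [co cl _] e f eE fE.
have /eqP/cards2P[a [b [_ ee]]] := graph_induced gE eE.
have /eqP/cards2P[c [d [_ ff]]] := graph_induced gE fE.
have ab : adj (induced_graph E A) a b by rewrite /adj -ee.
have cd : adj (induced_graph E A) c d by rewrite /adj -ff.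
have bA : b \in A by move: ab; rewrite adj_induced => /and3P[].
have cA : c \in A by move: cd; rewrite adj_induced => /and3P[].
have /connectP[p pb ec] := co b c bA cA.
exists (a :: b :: rcons p d); split.
- rewrite /= ab rcons_path -ec cd andbT.
  (* By closedness the path never leaves A, so its edges survive in the induced graph. *)
  elim: p b bA pb {ab ec ee} => //= x p IH b bA /andP[bx xp].
  by rewrite adj_induced bx bA (cl _ _ bx)//= IH// (cl _ _ bx).
- by rewrite ee; apply/setP => x; rewrite inE [take _ _]/= take0 !inE.
- have -> : [:: a, b & rcons p d] = (a :: belast b p) ++ [:: c; d].
    by rewrite -rcons_cons (lastI b p) -ec -!cats1 -catA.
  by rewrite size_cat addnK drop_size_cat// ff; apply/setP => x; rewrite !inE.
Qed.

(* The neighbourhood of a vertex w of maximum degree is independent, so every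
   edge has an end among the other points of A. *)
Lemma mantel E A : is_graph E -> #|A| ^ 2 < 2 * #|arcs (induced_graph E A)| ->
  has_switcher (induced_graph E A).
Proof.
move=> gE; set r := induced_graph E A; apply: contraPP => notri; apply/negP.
rewrite -leqNgt.
have gr : is_graph r by apply: graph_induced.
case: (pickP (@predT V)) => [x0 _|V0]; last first.
  by rewrite card_arcs_nbrs big_pred0 ?muln0.
have [w _ wmax] := @arg_maxnP V x0 xpredT (fun v => #|nbrs r v|) isT.
have NA : nbrs r w \subset A.
  by apply/subsetP => v; rewrite inE adj_induced => /and3P[].
pose Q := [set p in arcs r | p.1 \notin nbrs r w].
have QA : #|Q| <= (#|A| - #|nbrs r w|) * #|nbrs r w|.
  rewrite -cardsDS// card_fibers.
  rewrite (bigID (mem (A :\: nbrs r w))) /= [X in _ + X]big1 ?addn0; last first.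
    move=> u; rewrite !inE => h; apply: eq_card0 => v.
    rewrite !inE /= adj_induced; apply/negP => /andP[/and3P[_ uA _] uN].
    by move: h; rewrite uA uN.
  rewrite -sum_nat_const; apply: leq_sum => u _.
  apply: leq_trans (wmax u isT); apply/subset_leq_card/subsetP => v.
  by rewrite !inE => /andP[].
have le : #|arcs r| <= #|Q| + #|@swap_pair V V @: Q|.
  apply: leq_trans (leq_card_setU _ _).1.
  apply/subset_leq_card/subsetP => -[u v]; rewrite inE /= => uv.
  rewrite !inE /= uv /=; case: (boolP (adj r w u)) => //= wu.
  apply/imsetP; exists (v, u) => //; rewrite !inE /= adjC uv /=.
  by apply/negP => wv; apply: notri; exists w, u, v.
have := (nat_AGM2 (#|A| - #|nbrs r w|) #|nbrs r w|).1.
rewrite subnK; last exact: subset_leq_card.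
have := leq_imset_card (@swap_pair V V) Q; move: QA le.
move: (_ ^ 2) (_ * #|nbrs r w|) #|imset _ _| #|Q| #|arcs r|; clear; lia.
Qed.

(** Without a common edge, every ordered pair in the intersection of A and A' is missing from one of
    the two graphs. This bounds the square of its size by the total number of missing pairs, against
    [intersection_arith]. *)
Lemma giant_share E E' A A' : giant E A -> giant E' A' ->
  5 * #|V| ^ 2 < 9 * #|arcs E| -> 5 * #|V| ^ 2 < 9 * #|arcs E'| ->
  share_edge (induced_graph E A) (induced_graph E' A').
Proof.
move=> gA gA' d d'; apply: contrapT => nshare.
have := card_arcs_giant gA; have := card_arcs_giant gA'.
have [[_ _ lA] [_ _ lA']] := (gA, gA').
have sub (F : {set {set V}}) B : arcs (induced_graph F B) \subset setX B B.
  apply/subsetP => -[u v]; rewrite !inE adj_induced.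
  by move=> /and3P[_ -> ->].
have le : #|A :&: A'| ^ 2 <= (#|A| ^ 2 - #|arcs (induced_graph E A)|)
                          + (#|A'| ^ 2 - #|arcs (induced_graph E' A')|).
  rewrite -!mulnn -!cardsX -!cardsDS ?sub//.
  apply: leq_trans (leq_card_setU _ _).1; apply/subset_leq_card/subsetP => -[u v].
  rewrite !inE /= => /andP[/andP[-> ->] /andP[-> ->]]; rewrite !andbT -negb_and.
  by apply/negP => /andP[h h']; apply: nshare; exists [set u; v].
have := subset_leq_card (sub E A); have := subset_leq_card (sub E' A').
rewrite !cardsX => c' c.
suff : #|A| + #|A'| <= #|V| + #|A :&: A'|.
  move: d d' le; rewrite -!mulnn => d d' le U g' g; move: le; rewrite leqNgt.
  by rewrite (intersection_arith lA lA' _ _ U d d' g g' c c') ?max_card.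
by rewrite -cardsUI leq_add2r max_card.
Qed.

End Graph.

(** * Fractional matchings in a large component *)

(** Take for b the number of points of A in both X and Y. An edge avoiding these points is covered
    in both orientations, so its ends lie both in X or both in Y; the two resulting squares are
    merged by x^2 + y^2 <= (x + y)^2. *)
Lemma cover_arcs_bound (V : finType) (E : {set {set V}}) (A X Y : {set V}) :
  covers (arcs (induced_graph E A)) X Y ->
  exists b, [/\ b <= #|A|, 2 * b <= #|X| + #|Y| &
    #|arcs (induced_graph E A)| <=
      b * #|A| + (#|A| - b) * b + (#|X| + #|Y| - 2 * b) ^ 2].
Proof.
move=> /forall_inP c; set B := X :&: Y :&: A.
have BA : B \subset A by apply: subsetIr.
have BX : B \subset X by rewrite /B -setIA subsetIl.
have BY : B \subset Y by rewrite /B -setIA setIC -setIA subsetIl.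
exists #|B|; split; first exact: subset_leq_card.
  by rewrite mul2n -addnn leq_add// subset_leq_card.
have : #|arcs (induced_graph E A)| <= #|B| * #|A| + (#|A| - #|B|) * #|B|
    + (#|X| - #|B|) ^ 2 + (#|Y| - #|B|) ^ 2.
  rewrite -!cardsDS// -!mulnn -!cardsX.
  pose T := setX B A :|: setX (A :\: B) B :|: setX (X :\: B) (X :\: B).
  apply: (@leq_trans #|T :|: setX (Y :\: B) (Y :\: B)|); last first.
    apply: leq_trans (leq_card_setU _ _).1 _; rewrite leq_add2r.
    apply: leq_trans (leq_card_setU _ _).1 _; rewrite leq_add2r.
    exact: (leq_card_setU _ _).1.
  apply/subset_leq_card/subsetP => -[u v] uv.
  have vu : (v, u) \in arcs (induced_graph E A) by move: uv; rewrite !inE /= adjC.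
  have := c _ uv; have := c _ vu.
  move: uv; rewrite !inE /= adj_induced => /and3P[_ -> ->].
  by case: (u \in X); case: (u \in Y); case: (v \in X); case: (v \in Y).
have := subset_leq_card BX; have := subset_leq_card BY.
move: #|B| ((#|A| - _) * _)%N => b m2; move: #|arcs _| => r.
move: (_ * #|A|)%N => m1 bX bY.
have [x ->] : exists x, #|X| = b + x by exists (#|X| - b); lia.
have [y ->] : exists y, #|Y| = b + y by exists (#|Y| - b); lia.
have -> : b + x + (b + y) - 2 * b = x + y by lia.
rewrite !addKn -!mulnn; clear; lia.
Qed.

Local Open Scope ring_scope.

(** A vertex lies in at most two arcs of M, once as first and once as second coordinate. Weight
    s/|M| <= 1/2 on each arc, added up over the orientations of an edge, gives total weight exactly
    s. *)
Lemma matching_fractional (R : realType) (V : finType) (E : {set {set V}})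
    (M : {set V * V}) (s : R) :
  M \subset arcs E -> {in M &, injective fst} -> {in M &, injective snd} ->
  0 <= s -> 2 * s <= #|M|%:R ->
  exists2 w : {set V} -> R, fractional_matching E w & \sum_(e in E) w e = s.
Proof.
move=> ME inj1 inj2 s0 sM.
have [M0|M0] := posnP #|M|.
  have -> : s = 0 by apply/eqP; rewrite eq_le s0 andbT; move: sM; rewrite M0; lra.
  exists (fun _ => 0); last by rewrite big1.
  by split=> [e _|v]; rewrite ?lexx ?ler01// big1.
pose c : R := s / #|M|%:R.
have M0R : 0 < #|M|%:R :> R by rewrite ltr0n.
have c0 : 0 <= c by rewrite divr_ge0// ltW.
have c1 : c <= 2^-1 by rewrite ler_pdivrMr//; lra.
pose w (e : {set V}) : R := \sum_(p in M | [set p.1; p.2] == e) c.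
have sumw (P : pred {set V}) :
    \sum_(e in E | P e) w e = \sum_(p in M | P [set p.1; p.2]) c.
  rewrite [RHS](partition_big (fun p => [set p.1; p.2]%SET)
    (fun e => (e \in E) && P e)) /=; last first.
    move=> p /andP[pM ->]; rewrite andbT.
    by have := fintype.subsetP ME _ pM; rewrite inE.
  apply: eq_bigr => e /andP[eE Pe]; apply: eq_bigl => p.
  by rewrite -andbA; case: eqP => [->|]; rewrite ?Pe ?andbF.
have cardle (Q : {set V * V}) (f : V * V -> V) v :
    {in Q &, injective f} -> (forall p, p \in Q -> f p = v) -> (#|Q| <= 1)%N.
  move=> fi fv; apply/card_le1_eqP => p q pQ qQ.
  by apply: fi => //; rewrite !fv.
have vertex v : \sum_(e in E | v \in e) w e <= 1.
  rewrite (sumw (fun e => v \in e)).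
  have -> : \sum_(p in M | v \in [set p.1; p.2]%SET) c
      = c *+ #|[set p in M | v \in [set p.1; p.2]%SET]|.
    by rewrite -sumr_const; apply: eq_bigl => p; rewrite inE.
  have le2 : (#|[set p in M | v \in [set p.1; p.2]%SET]| <= 2)%N.
    apply: (@leq_trans (#|[set p in M | p.1 == v]%SET| + #|[set p in M | p.2 == v]%SET|)).
      apply: leq_trans (leq_card_setU _ _).1; apply/subset_leq_card.
      apply/fintype.subsetP => p; rewrite !inE => /andP[-> /=].
      by rewrite ![v == _]eq_sym.
    apply: (@leq_add _ _ 1 1).
      apply: (cardle _ fst v) => [p q|p]; rewrite !inE.
        by move=> /andP[pM _] /andP[qM _]; apply: inj1.
      by move=> /andP[_ /eqP].
    apply: (cardle _ snd v) => [p q|p]; rewrite !inE.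
      by move=> /andP[pM _] /andP[qM _]; apply: inj2.
    by move=> /andP[_ /eqP].
  rewrite -mulr_natr; have : #|[set p in M | v \in [set p.1; p.2]%SET]|%:R <= 2 :> R.
    by rewrite ler_nat.
  by move: (_%:R) => x hx; nra.
have w0 e : 0 <= w e by apply: sumr_ge0.
exists w.
  split=> // e eE; rewrite w0 /=.
  (* The sum at any point of e bounds the weight of e; an empty e underlies no arc and has weight
     0. *)
  have [->|[v ve]] := set_0Vmem e.
    rewrite /w big1 ?ler01// => p /andP[_ /eqP/setP/(_ p.1)].
    by rewrite !inE eqxx.
  apply: le_trans (vertex v); rewrite (bigD1 e)/= ?eE//.
  by rewrite lerDl sumr_ge0.
have := sumw xpredT; rewrite (eq_bigl (mem E)) => [->|e]; last by rewrite andbT.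
rewrite (eq_bigl (mem M)) => [|e]; last by rewrite andbT.
by rewrite sumr_const -mulr_natr divfK// gt_eqF.
Qed.

(** In units of |V|, a is the size of the component, c that of the cover, and b that of its doubly
    used part in the component. *)
Lemma density_arith (R : realType) (a b c eps nu : R) :
  2 / 3 <= a <= 1 -> 0 <= b -> 2 * b <= c -> c <= 2 * (1 / 3 + eps) ->
  0 <= eps <= 1 / 7 -> 5 * eps < nu ->
  5 / 9 + nu <= (2 * b * a - b ^+ 2 + (c - 2 * b) ^+ 2) + (1 - a) ^+ 2 -> False.
Proof.
move=> /andP[a1 a2] b0 bc ce /andP[e0 e1] en h.
have h1 : (c - 2 * b) ^+ 2 <= (2 * (1 / 3 + eps) - 2 * b) ^+ 2.
  by rewrite ler_sqr ?nnegrE; lra.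
(* At eps = 0 the maximum 5/9 is reached at (a, b) = (2/3, 0) and (1, 1/3); [k1] and [k2] replace
   the squares of b and a by chords. Values of b above 1/3 exceed it by at most eps, which nu
   absorbs. *)
have [b3|b3] := leP b (1 / 3).
  have k1 : b * (1 / 3 - b) >= 0 by rewrite mulr_ge0//; lra.
  have k2 : (1 - a) * (a - 2 / 3) >= 0 by rewrite mulr_ge0//; lra.
  nra.
nra.
Qed.

Lemma giant_matching (R : realType) (V : finType) (E : {set {set V}})
    (A : {set V}) (nu eps s : R) :
  giant E A -> (0 < #|V|)%N ->
  (5 / 9 + nu) * #|V|%:R ^+ 2 <= #|arcs E|%:R ->
  0 <= eps <= 1 / 7 -> 5 * eps < nu -> 0 <= s <= (1 / 3 + eps) * #|V|%:R ->
  exists2 w : {set V} -> R, fractional_matching (induced_graph E A) w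
    & \sum_(e in induced_graph E A) w e = s.
Proof.
move=> gA t0 dE eps01 epsnu /andP[s0 sle].
have s20 : 0 <= 2 * s by lra.
(* The least integer above 2s: a cover with fewer than [m] points has at most 2s, and [m] arcs carry
   weight s at no more than 1/2 each. *)
set m := (Num.truncn (2 * s)).+1.
have : cover_ge m (arcs (induced_graph E A)).
  apply/cover_geP => X Y cXY; rewrite leqNgt ltnS; apply/negP => small.
  have [b [bA bc le]] := cover_arcs_bound cXY.
  have csmall : (#|X| + #|Y|)%:R <= 2 * s.
    by rewrite -truncn_ge_nat.
  have T0 : 0 < #|V|%:R :> R by rewrite ltr0n.
  have T20 : 0 < #|V|%:R ^+ 2 :> R by rewrite exprn_gt0.
  have := card_arcs_giant gA; case: gA => _ _ lA gle.
  have AV : (#|A| <= #|V|)%N by apply: max_card.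
  apply: (@density_arith R (#|A|%:R / #|V|%:R) (b%:R / #|V|%:R)
    ((#|X| + #|Y|)%:R / #|V|%:R) eps nu) => //.
  - rewrite ler_pdivlMr// ler_pdivrMr// mul1r ler_nat AV andbT.
    by move: lA; rewrite -(ler_nat R) !natrM; lra.
  - by rewrite mulrA ler_pM2r ?invr_gt0// -natrM ler_nat.
  - by rewrite ler_pdivrMr//; lra.
  rewrite -(ler_pM2r T20); apply: le_trans dE _.
  have := leq_trans gle (leq_add le (leqnn _)).
  rewrite -(ler_nat R) !natrD !natrX !natrB// !natrD !natrM natrB//.
  move=> h; apply: le_trans h _.
  rewrite le_eqVlt; apply/orP; left; apply/eqP; field.
  by rewrite gt_eqF.
move=> /konig[M [ME inj1 inj2 mM]]; apply: (matching_fractional ME inj1 inj2 s0).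
by apply: le_trans (ltW (truncnS_gt _)) _ => //; rewrite ler_nat.
Qed.

(** * Edge density, switchers and large neighbourhoods *)

(** At most a third of the points lie outside A, which costs at most 1/9 of the density. *)
Lemma giant_density (R : realType) (V : finType) (E : {set {set V}})
    (A : {set V}) (nu : R) :
  is_graph E -> giant E A -> (1 < #|V|)%N -> 0 <= nu ->
  (5 / 9 + nu) * #|V|%:R ^+ 2 <= #|arcs E|%:R ->
  (4 / 9 + nu) * #|V|%:R ^+ 2 <= #|arcs (induced_graph E A)|%:R.
Proof.
move=> gE gA t1 nu0 dE.
have := card_arcs_giant gA; case: gA => _ _ lA.
have AV : (#|A| <= #|V|)%N by apply: max_card.
rewrite -(ler_nat R) natrD natrX natrB// => le.
have AVR : #|A|%:R <= #|V|%:R :> R by rewrite ler_nat.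
have : (2 * #|V|)%:R <= (3 * #|A|)%:R :> R by rewrite ler_nat.
rewrite !natrM => lAR.
have : (#|V|%:R - #|A|%:R) ^+ 2 <= (1 / 3 * #|V|%:R) ^+ 2 :> R.
  by rewrite ler_sqr ?nnegrE; lra.
by move: dE le; rewrite expr2; nra.
Qed.

Lemma giant_edge_density (R : realType) (V : finType) (E : {set {set V}})
    (A : {set V}) (nu : R) :
  is_graph E -> giant E A -> (1 < #|V|)%N -> 0 <= nu ->
  (5 / 9 + nu) * #|V|%:R ^+ 2 <= #|arcs E|%:R ->
  4 / 9 + nu <= edge_density R (induced_graph E A).
Proof.
move=> gE gA t1 nu0 dE; have := giant_density gE gA t1 nu0 dE.
rewrite card_arcs; last exact: graph_induced.
rewrite /edge_density ler_pdivlMr ?ltr0n ?bin_gt0// => h.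
(* As 2 binom(t, 2) <= t^2, normalising by the binomial can only raise the density. *)
have : ('C(#|V|, 2) * 2)%:R <= #|V|%:R ^+ 2 :> R.
  rewrite -natrX ler_nat (bin_ffact _ 2) ffactnS ffactn1 -mulnn.
  by rewrite leq_mul2l leq_pred orbT.
by move: h; rewrite !natrM; nra.
Qed.

Lemma giant_switcher (V : finType) (E : {set {set V}}) (A : {set V}) :
  is_graph E -> giant E A -> (0 < #|V|)%N -> (5 * #|V| ^ 2 < 9 * #|arcs E|)%N ->
  has_switcher (induced_graph E A).
Proof.
move=> gE gA t0 dE; apply: mantel => //.
have := card_arcs_giant gA; case: gA => _ _ lA.
have AV : (#|A| <= #|V|)%N by apply: max_card.
have [b e] : exists b, #|V| = (#|A| + b)%N.
  by exists (#|V| - #|A|)%N; rewrite subnKC.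
(* A giant set has at least twice as many points inside as outside; in b and r the inequality needed
   for [mantel] compares polynomials with nonnegative difference. *)
have [r er] : exists r, #|A| = (2 * b + r)%N.
  by exists (#|A| - 2 * b)%N; move: lA; rewrite e; lia.
move: t0 dE; rewrite e addKn er -!mulnn.
move: #|arcs (induced_graph _ _)| #|arcs E| => c d; clear; nia.
Qed.

(** The average degree exceeds 4t/9. More than t/3 neighbours are wanted because such a
    neighbourhood meets every giant set. *)
Lemma giant_large_nbrs (V : finType) (E : {set {set V}}) (A : {set V}) :
  giant E A -> (0 < #|V|)%N -> (5 * #|V| ^ 2 < 9 * #|arcs E|)%N ->
  exists x, (#|V| < 3 * #|nbrs (induced_graph E A) x|)%N.
Proof.
move=> gA t0 dE; apply: contrapT => /forallNP small.
have : (3 * #|arcs (induced_graph E A)| <= #|V| * #|V|)%N.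
  rewrite card_arcs_nbrs big_distrr /= -sum_nat_const; apply: leq_sum => x _.
  by rewrite leqNgt; apply/negP/small.
have := card_arcs_giant gA; case: gA => _ _ lA.
have AV : (#|A| <= #|V|)%N by apply: max_card.
have [b e] : exists b, #|V| = (#|A| + b)%N.
  by exists (#|V| - #|A|)%N; rewrite subnKC.
have [r er] : exists r, #|A| = (2 * b + r)%N.
  by exists (#|A| - 2 * b)%N; move: lA; rewrite e; lia.
move: t0 dE; rewrite e addKn er -!mulnn.
move: #|arcs (induced_graph _ _)| #|arcs E| => c d; clear; nia.
Qed.

Lemma imset_ord_nth (V : finType) (x0 : V) (f : nat -> V) (n : nat) (s : seq V) :
  size s = n -> (forall m, (m < n)%N -> f m = nth x0 s m) ->
  [set f m | m : 'I_n]%SET = [set u in s]%SET.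
Proof.
move=> sn fE; apply/setP => u; rewrite inE; apply/imsetP/(nthP x0).
  by move=> [m _ ->]; exists m; rewrite ?sn ?fE.
rewrite sn; move=> [m mn <-]; exists (Ordinal mn); rewrite //= fE//.
Qed.

(** * Links of (1,k-2)-sets and the construction of arcs *)

Section Links.
Variables (C V : finType) (k : nat).
Implicit Types (H : graph1 C V k) (S : C * {set V}).

Lemma shadow_at_colourP H i S :
  reflect [/\ S.1 = i, #|S.2| = (k - 2)%N &
             exists2 Y : {set V}, S.2 \subset Y & (i, Y) \in edges H]
          (S \in edges (shadow (k - 2) (at_colour H i))).
Proof.
apply: (iffP idP) => [|[S1 S2 [Y SY YH]]].
  rewrite inE => /andP[/eqP Sk /exists_inP[[c Y] + /andP[/eqP /= S1 SY]]].
  rewrite inE /= => /andP[YH /eqP ci]; subst.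
  by split=> //; exists Y.
rewrite inE S2 eqxx; apply/exists_inP; exists (i, Y); rewrite ?inE ?YH /= ?eqxx//.
by rewrite /sub1 S1 eqxx.
Qed.

Lemma graph_link H S : (1 < k)%N -> #|S.2| = (k - 2)%N -> is_graph (link H S).
Proof.
move=> k1 Sk X; rewrite inE => /andP[dis /(forall_inP (edgesP H)) /andP[_ /= /eqP]].
by have := cardsUI X S.2; rewrite (disjoint_setI0 dis) cards0 Sk; lia.
Qed.

(** Deleting the points of S maps the edges above S injectively into the link. *)
Lemma deg_at_colour_le_link H i S : (deg (at_colour H i) S <= #|link H S|)%N.
Proof.
have setDUK (A B : {set V}) : B \subset A -> A :\: B :|: B = A.
  by move=> BA; rewrite setUC -{1}(setIidPr BA) setID.
rewrite /deg -(@card_in_imset _ _ (fun e : C * {set V} => e.2 :\: S.2)).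
  apply/subset_leq_card/fintype.subsetP => _ /imsetP[e + ->].
  rewrite !inE => /andP[/andP[eH _] /andP[/eqP S1 S2]].
  rewrite setDUK// S1 -surjective_pairing eH andbT.
  by rewrite -setI_eq0 setDE -setIA (setIC (~: _)) setICr setI0.
move=> [c X] [c' X']; rewrite !inE /=.
move=> /andP[_ /andP[/eqP /= <- S2]] /andP[_ /andP[/eqP /= <- S2']] e.
by congr pair; rewrite -(setDUK _ _ S2) -(setDUK _ _ S2') e.
Qed.

(** Replacing 2 binom(t - k + 2, 2) by t^2 costs a term of order kt, for which half of mu pays once
    8k <= mu t. *)
Lemma arcs_link (R : realType) H i S (mu : R) :
  (1 < k)%N -> #|S.2| = (k - 2)%N -> 0 < mu <= 1 ->
  8 * k%:R <= mu * #|V|%:R -> 5 / 9 + mu <= rel_deg R (at_colour H i) S ->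
  (5 / 9 + mu / 2) * #|V|%:R ^+ 2 <= #|arcs (link H S)|%:R.
Proof.
move=> k1 Sk /andP[mu0 mu1] large.
have kV : k%:R <= #|V|%:R :> R.
  have : 0 <= #|V|%:R :> R by []. 
  have : 0 <= k%:R :> R by [].
  by nra.
have kV' : (k <= #|V|)%N by rewrite ler_nat in kV.
rewrite /rel_deg Sk ler_pdivlMr; last by rewrite ltr0n bin_gt0; lia.
have -> : (k - (k - 2) = 2)%N by lia.
move=> h; have {h} : (5 / 9 + mu) * 'C(#|V| - (k - 2), 2)%:R <= #|link H S|%:R.
  by apply: le_trans h _; rewrite ler_nat deg_at_colour_le_link.
rewrite card_arcs; last exact: graph_link.
have : (#|V| - k)%:R ^+ 2 <= ('C(#|V| - (k - 2), 2) * 2)%:R :> R.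
  rewrite -natrX ler_nat (bin_ffact _ 2) ffactnS ffactn1 -mulnn.
  by apply: leq_mul; lia.
rewrite natrB// !natrM => b l.
have : (5 / 9 + mu / 2) * #|V|%:R ^+ 2 <= (5 / 9 + mu) * (#|V|%:R - k%:R) ^+ 2.
  have k0 : 0 <= k%:R :> R by [].
  move: #|V|%:R k%:R large kV k0 => t c l' ct c0.
  have p1 : 0 <= (mu * t - 8 * c) * t by rewrite mulr_ge0 ?subr_ge0//; lra.
  have p2 : 0 <= (1 - mu) * (t * c) by rewrite !mulr_ge0 ?subr_ge0//; lra.
  have p3 : 0 <= t * c by rewrite mulr_ge0//; lra.
  have p4 : 0 <= (5 / 9 + mu) * c ^+ 2 by rewrite mulr_ge0 ?sqr_ge0//; lra.
  by nra.
have : 0 <= 5 / 9 + mu by lra.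
by nra.
Qed.

(** Let X consist of x1 and q, and let x have more than |V|/3 neighbours in C_X. Exchanging x1 for x
    gives X2, whose component contains a neighbour y of x; with z a neighbour of y in C_{X2}, the
    arc is x1, q, x, y, z. *)
Lemma arc_exists H i (CC : C * {set V} -> {set {set V}}) :
  (2 < k)%N ->
  (forall S, S \in edges (shadow (k - 2) (at_colour H i)) ->
     (5 * #|V| ^ 2 < 9 * #|arcs (link H S)|)%N /\
     exists2 A, giant (link H S) A & CC S = induced_graph (link H S) A) ->
  (exists S, S \in edges (shadow (k - 2) (at_colour H i))) ->
  exists v, is_arc H CC i v.
Proof.
move=> k2 good [[j X] SD].
have /shadow_at_colourP[/= ji cX _] := SD; subst j.
have [d [A gA eC]] := good _ SD.
have V0 : (0 < #|V|)%N.
  by apply: leq_trans (max_card X); rewrite cX subn_gt0.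
have [x xbig] := giant_large_nbrs gA V0 d.
rewrite -eC in xbig.
(* Any neighbour serves here: it shows that x is outside X and that X2 lies in an edge. *)
have [z0 z0x] : exists z, adj (CC (i, X)) x z.
  have /card_gt0P[z] : (0 < #|nbrs (CC (i, X)) x|)%N by lia.
  by rewrite inE; exists z.
have inlink z : adj (CC (i, X)) x z ->
    [/\ x \notin X, z \notin X & (i, [set x; z] :|: X) \in edges H].
  rewrite eC /adj inE => /andP[+ _]; rewrite inE /= => /andP[dis ->].
  have nX y : y \in [set x; z]%SET -> y \notin X.
    by move=> yy; have /pred0P/(_ y) := dis; rewrite /= yy /= => ->.
  by rewrite !nX ?set21 ?set22.
have [xX _ eH] := inlink _ z0x.
have cE : size (enum X) = (k - 2)%N by rewrite -cardE.
case eX : (enum X) => [|x1 q]; first by move: cE; rewrite eX /=; lia.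
have Xq : X =i x1 :: q by move=> y; rewrite -eX mem_enum.
pose X2 := [set y in rcons q x]%SET.
have cX2 : #|X2| = (k - 2)%N.
  rewrite cardsE (card_uniqP _) ?size_rcons -?cE ?eX// rcons_uniq.
  have := enum_uniq X; rewrite eX /= => /andP[_ ->]; rewrite andbT.
  by apply: contra xX; rewrite Xq inE => ->; rewrite orbT.
have SD2 : (i, X2) \in edges (shadow (k - 2) (at_colour H i)).
  apply/shadow_at_colourP; split=> //; exists ([set x; z0] :|: X) => //=.
  apply/fintype.subsetP => y; rewrite !inE mem_rcons inE Xq inE.
  by case/orP=> ->; rewrite ?orbT.
have [d2 [A2 gA2 eC2]] := good _ SD2.
(* More than |V|/3 neighbours and at least 2|V|/3 points of A2 must overlap. *)
have [y xy yA2] : exists2 y, adj (CC (i, X)) x y & y \in A2.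
  have : (0 < #|nbrs (CC (i, X)) x :&: A2|)%N.
    have := cardsUI (nbrs (CC (i, X)) x) A2.
    have := max_card (nbrs (CC (i, X)) x :|: A2); case: gA2 => _ _; lia.
  by move=> /card_gt0P[y]; rewrite !inE => /andP[]; exists y.
have A21 : (1 < #|A2|)%N.
  have := max_card (x |: X); rewrite cardsU1 xX cX.
  by case: gA2 => _ _; lia.
have [z yz] := giant_nbr A21 gA2 yA2.
rewrite -eC2 in yz.
(* The leading x only fills index 0, as arcs are numbered from 1. *)
exists (nth z (x :: x1 :: q ++ [:: x; y; z])).
have sq : size q = (k - 3)%N by move: cE; rewrite eX /=; lia.
set s := (_ :: _).
have sE m : nth z s m.+1 = nth z (x1 :: rcons q x ++ [:: y; z]) m.
  by rewrite /s /= -cats1 -catA.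
move: s sE => s sE.
have nk1 : nth z s (k - 1) = x.
  have -> : (k - 1 = (size q).+2)%N by lia.
  by rewrite sE /= nth_cat size_rcons ltnSn nth_rcons ltnn eqxx.
have nk : nth z s k = y.
  have -> : (k = (size q).+3)%N by lia.
  by rewrite sE /= nth_cat size_rcons ltnn subnn.
have nk2 : nth z s k.+1 = z.
  have -> : (k = (size q).+3)%N by lia.
  by rewrite sE /= nth_cat size_rcons ltnNge leqnSn /= subSnn.
have e1 : [set nth z s m.+1 | m : 'I_(k - 2)]%SET = X.
  have <- : [set u in x1 :: q]%SET = X by apply/setP => u; rewrite Xq inE.
  apply: (@imset_ord_nth _ z (fun m => nth z s m.+1)) => [|m mk].
    by rewrite /= sq; lia.
  rewrite sE -cats1 -!catA -cat_cons nth_cat /= sq.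
  by case: ifP => //; lia.
have e2 : [set nth z s m.+2 | m : 'I_(k - 2)]%SET = X2.
  apply: (@imset_ord_nth _ z (fun m => nth z s m.+2)) => [|m mk].
    by rewrite size_rcons sq; lia.
  by rewrite sE /= nth_cat size_rcons sq; case: ifP => //; lia.
by rewrite /is_arc e1 e2 nk1 nk nk2.
Qed.

End Links.

(** * Choice of constants and assembly of the family *)

(** An empty shadow would have all (1,j)-sets of colour i in its complement, of density 1. Through
    (P2) this supplies the first set of an arc. *)
Lemma shadow_nonempty (R : realType) (C V : finType) (k j : nat)
    (H : graph1 C V k) (i : C) :
  i \in colours H -> (j <= #|V|)%N ->
  density1 R (compl (shadow j (at_colour H i))) < 1 ->
  exists S, S \in edges (shadow j (at_colour H i)).
Proof.
move=> iH jV; apply: contraPP => /forallNP none; apply/negP; rewrite -leNgt.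
have ci : #|colours (compl (shadow j (at_colour H i)))| = 1%N.
  rewrite /= (_ : _ :&: _ = [set i]) ?cards1//.
  by apply/setIidPr; rewrite sub1set.
rewrite /density1 ci mul1n ler_pdivlMr ?ltr0n ?bin_gt0// mul1r ler_nat.
have inj : injective (pair i : {set V} -> _) by move=> X Y [].
rewrite -card_draws -(card_imset _ inj).
apply/subset_leq_card/fintype.subsetP => _ /imsetP[X + ->]; rewrite inE => Xj.
rewrite inE /= in_setI in_set1 iH eqxx Xj /=.
by apply/negP/none.
Qed.

Lemma forces_rainbow_hamilton_5_9 (R : realType) (k : nat) :
  (3 <= k)%N -> forces_rainbow_hamilton k (5 / 9 : R).
Proof.
(* With eps = 4/3 gamma and nu = mu/2, gamma <= mu/20 yields 5 eps <= mu/3 < nu and eps <= 1/7. *)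
move=> k3 mu /andP[mu0 mu1]; exists (mu / 20) => [|gamma /andP[gamma0 gammale]].
  by rewrite divr_gt0.
exists (1 / 2) => [|alpha /andP[alpha0 alphale]]; first by rewrite divr_gt0.
have kR : 3 <= k%:R :> R by rewrite ler_nat.
(* The density in (V4) is therefore 1/k + (1 + 1/k) gamma, at most 1/3 + 4/3 gamma for k >= 3. *)
have eV4 : (1 + k%:R^-1) * k.+1%:R^-1 = k%:R^-1 :> R.
  by rewrite -natr1; field; apply/andP; split; lra.
have gV5 : 1 - 5 / 9 + gamma <= 4 / 9 + mu / 2 by lra.
have nu0 : 0 <= mu / 2 by lra.
have k2k : (1 <= k - 2 <= k - 2)%N by lia.
have k1 : (1 < k)%N by lia.
(* This bound on 1/t is the condition 8k <= mu t of [arcs_link]. *)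
exists (mu / (8 * k%:R)) => [|t t0 tle V H cV cH Hdeg].
  by rewrite divr_gt0// mulr_gt0//; lra.
have large : 8 * k%:R <= mu * #|V|%:R.
  have tR : 0 < t%:R :> R by rewrite ltr0n.
  rewrite cV; move: tle; rewrite ler_pdivlMr; last by lra.
  by rewrite mulrC ler_pdivrMr.
have V0 : (0 < #|V|)%N by rewrite cV.
have kV : (8 * k <= #|V|)%N.
  have V0R : 0 <= #|V|%:R :> R by [].
  by rewrite -(ler_nat R) natrM; apply: le_trans large _; nra.
have V1 : (1 < #|V|)%N by lia.
have k2V : (k - 2 <= #|V|)%N by lia.
pose D i := edges (shadow (k - 2) (at_colour H i)).
have Dgraph i S : S \in D i -> is_graph (link H S).
  by move=> /shadow_at_colourP[_ Sk _]; apply: graph_link.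
have Darcs i S : S \in D i ->
    (5 / 9 + mu / 2) * #|V|%:R ^+ 2 <= #|arcs (link H S)|%:R.
  move=> SD; have /shadow_at_colourP[_ Sk _] := SD.
  apply: (@arcs_link _ _ _ _ _ i) => //; first by rewrite mu0.
  by have [P1 _ _] := Hdeg i _ k2k; apply: P1.
have Darcs9 i S : S \in D i -> (5 * #|V| ^ 2 < 9 * #|arcs (link H S)|)%N.
  move=> /Darcs; rewrite -(ltr_nat R) natrM natrX natrM => h.
  have : 0 < mu * #|V|%:R ^+ 2 by rewrite mulr_gt0// exprn_gt0// ltr0n.
  by nra.
(* [f] chooses one giant component for each set in a shadow; the empty set is a dummy value
   elsewhere. *)
have [f fP] : {f : 'I_t * {set V} -> {set V} &
    forall S, (exists i, S \in D i) -> giant (link H S) (f S)}.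
  apply: (@choice _ _ (fun S A => (exists i, S \in D i) -> giant (link H S) A)) => S.
  have [[i SD]|no] := pselect (exists i, S \in D i).
    have [A gA] := giant_exists (Dgraph _ _ SD) (ltnW (Darcs9 _ _ SD)).
    by exists A.
  by exists set0.
have gf i S : S \in D i -> giant (link H S) (f S) by move=> SD; apply: fP; exists i.
exists (fun S => induced_graph (link H S) (f S)).
  by move=> S _; apply/fintype.subsetP => e; rewrite inE => /andP[].
(* The colours may agree or differ, so this gives both (V2) and (V6). *)
have share i j S T : S \in D i -> T \in D j -> share_edge
    (induced_graph (link H S) (f S)) (induced_graph (link H T) (f T)).
  move=> SD TD.
  exact: giant_share (gf _ _ SD) (gf _ _ TD) (Darcs9 _ _ SD) (Darcs9 _ _ TD).
split=> [i _ S SD|i _ S S'|i iH|i _ S SD|].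
- exact: giant_tightly_connected (Dgraph _ _ SD) (gf _ _ SD).
- exact: share.
- split=> [S SD|].
    exact: giant_switcher (Dgraph _ _ SD) (gf _ _ SD) V0 (Darcs9 _ _ SD).
  apply: arc_exists => // [S SD|].
    by split; [apply: Darcs9 SD|exists (f S) => //; apply: gf SD].
  apply: (@shadow_nonempty R) => //.
  by have [_ P2 _] := Hdeg i _ k2k; apply: le_lt_trans P2 _; lra.
- have [|||w wm ws] := @giant_matching R V _ _ (mu / 2) (4 / 3 * gamma)
    ((1 + k%:R^-1) * (k.+1%:R^-1 + gamma) * #|V|%:R) (gf _ _ SD) V0 (Darcs _ _ SD).
  + by apply/andP; split; lra.
  + by lra.
  + have k0 : 0 < k%:R^-1 :> R by rewrite invr_gt0; lra.
    have k13 : k%:R^-1 <= 3^-1 :> R by rewrite lef_pV2 ?posrE//; lra.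
    rewrite mulrDr eV4; apply/andP; split.
      by rewrite !mulr_ge0// addr_ge0 ?mulr_ge0//; lra.
    by rewrite ler_wpM2r//; nra.
  + exists w => //; rewrite /matching_density ws mulfK//.
    by rewrite pnatr_eq0 -lt0n.
- split=> [i _ S SD|i j _ _ _ S T]; last exact: share.
  have := giant_edge_density (Dgraph _ _ SD) (gf _ _ SD) _ _ (Darcs _ _ SD).
  by move=> h; apply: le_trans gV5 (h _ _).
Qed.

Theorem theorem1p17 (R : realType) (k : nat) (hk : (3 <= k)%N) :
  (rhv R k <= (5 / 9 : R)%:E)%E.
Proof.
apply: ereal_inf_lbound; exists (5 / 9) => //; split; first by rewrite divr_gt0.
exact: forces_rainbow_hamilton_5_9.
Qed.
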